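(* Let $r\ge 0$ be an integer and let $\mathcal{P}_r(\mathbb{R}^3)$ denote the polynomials of total degree at most $r$ in the three variables $\xi,\eta,\zeta$, regarded as functions on $\hat K$. Then (i) $\mathcal{P}_r(\mathbb{R}^3)\subset\phi\left(\mathcal{Q}^{[r,r]}_r\right)$; (ii) $\mathcal{P}_r(\mathbb{R}^3)\subset\phi\left(\mathcal{S}^{[r,r]}_r\right)$.
   Context: The infinite pyramid is $K_\infty=\{(x,y,z): 0\le x,y\le 1,\ 0\le z\le\infty\}$, where all points $(x,y,\infty)$ are identified to a single point. The reference pyramid is $\hat K=\{(\xi,\eta,\zeta)\in\mathbb{R}^3: 0\le \xi,\eta,\zeta,\ \xi\le 1-\zeta,\ \eta\le 1-\zeta\}$. The bijection $\phi:K_\infty\to\hat K$ is $\phi(x,y,z)=\left(\frac{x}{1+z},\frac{y}{1+z},\frac{z}{1+z}\right)$ for $0\le z<\infty$, and $\phi(x,y,\infty)=(0,0,1)$. For $u:\hat K\to\mathbb{R}$ put $\phi^*u=u\circ\phi:K_\infty\to\mathbb{R}$. For a space $W$ of real functions on $K_\infty$, put $\phi(W)=\{u:\hat K\to\mathbb{R} : \phi^*u\in W\}$. For a monomial $x^ay^b$, the superlinear degree $\mathrm{sldeg}(x^ay^b)$ is the sum of those exponents among $a,b$ that are different from $1$. The spaces of functions on $K_\infty$ are (with $a,b,c$ integers) $$\mathcal{Q}^{[r,r]}_r=\mathrm{span}\left\{\tfrac{x^ay^b}{(1+z)^c}: 0\le a,b\le c\le r\right\},$$ $$\mathcal{S}^{[r,r]}_r=\mathrm{span}\left\{\tfrac{x^ay^b}{(1+z)^c}: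 0\le a,b\le c\le r,\ \mathrm{sldeg}(x^ay^b)\le c\right\},$$ where each function $\frac{x^ay^b}{(1+z)^c}$ with $0\le a,b\le c$ is extended to $z=\infty$ by its limit (0 if $c>0$, and 1 if $a=b=c=0$). *)

(* Defs.v *)
From HB Require Import structures.
From mathcomp Require Import all_boot all_order all_algebra.
From mathcomp Require Import boolp classical_sets functions reals.
From mathcomp Require Import mpoly ring lra.

Set Implicit Arguments.
Unset Strict Implicit.
Unset Printing Implicit Defensive.

Import Order.TTheory GRing.Theory Num.Theory.

Local Open Scope classical_set_scope.
Local Open Scope ring_scope.

Definition linspan (R : realType) (V : lmodType R) (G : set V) : set V :=
  [set v | exists (n : nat) (k : 'I_n -> R) (g : 'I_n -> V),
     (forall i, G (g i)) /\ v = \sum_(i < n) k i *: g i].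

Definition in_Kfin (R : realType) (p : R * R * R) : bool :=
  let: (x, y, z) := p in [&& 0 <= x <= 1, 0 <= y <= 1 & 0 <= z].

(* All points at height z = +oo are identified, so the infinite pyramid is
   its finite part together with one extra point, [None]. *)
Definition Kinf (R : realType) : Type := option {p : R * R * R | in_Kfin p}.

Definition in_Khat (R : realType) (q : R * R * R) : bool :=
  let: (xi, eta, zeta) := q in
  [&& 0 <= xi, 0 <= eta, 0 <= zeta, xi <= 1 - zeta & eta <= 1 - zeta].

Definition Khat (R : realType) : Type := {q : R * R * R | in_Khat q}.

Definition phi_fin (R : realType) (p : R * R * R) : R * R * R :=
  let: (x, y, z) := p in (x / (1 + z), y / (1 + z), z / (1 + z)).

Lemma phi_fin_in_Khat (R : realType) (p : R * R * R) :
  in_Kfin p -> in_Khat (phi_fin p).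
Proof.
case: p => [[x y] z] /= /and3P[/andP[x0 x1] /andP[y0 y1] z0].
have z1 : 0 < 1 + z by lra.
have -> : 1 - z / (1 + z) = 1 / (1 + z) by field; lra.
by rewrite !divr_ge0 ?ler_pM2r ?invr_gt0 ?x1 ?y1 // ltW.
Qed.

Lemma apex_in_Khat (R : realType) : in_Khat (0 : R, 0 : R, 1 : R).
Proof. by rewrite /= subrr !lexx ler01. Qed.

Definition phi (R : realType) (p : Kinf R) : Khat R :=
  match p with
  | Some s => exist _ (phi_fin (sval s)) (phi_fin_in_Khat (proj2_sig s))
  | None => exist _ (0, 0, 1) (apex_in_Khat R)
  end.

(* [R^o] is [R] as a module over itself; it makes the function types
   [Kinf R -> R^o] and [Khat R -> R^o] real vector spaces. *)
Definition phi_space (R : realType) (W : set (Kinf R -> R^o)) :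
  set (Khat R -> R^o) := [set u : Khat R -> R^o | W (u \o @phi R)].

(* x^a y^b / (1 + z)^c. The value at infinity is the limit in the case of
   interest, a <= c and b <= c: it is 0 if c > 0, and 1 if a = b = c = 0. *)
Definition rat_mono (R : realType) (a b c : nat) (p : Kinf R) : R^o :=
  match p with
  | Some s => let: (x, y, z) := sval s in x ^+ a * y ^+ b / (1 + z) ^+ c
  | None => if c == 0%N then 1 else 0
  end.

Definition sldeg (a b : nat) : nat :=
  ((if a != 1 then a else 0) + (if b != 1 then b else 0))%N.

Definition Qspace (R : realType) (r : nat) : set (Kinf R -> R^o) :=
  linspan [set f | exists a b c : nat,
    [/\ (a <= c)%N, (b <= c)%N, (c <= r)%N & f = rat_mono a b c]].

Definition Sspace (R : realType) (r : nat) : set (Kinf R -> R^o) :=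
  linspan [set f | exists a b c : nat,
    [/\ (a <= c)%N, (b <= c)%N, (c <= r)%N, (sldeg a b <= c)%N
      & f = rat_mono a b c]].

(* [msize p] is the total degree of [p] plus one, and 0 for [p = 0]. *)
Definition Pspace (R : realType) (r : nat) : set (Khat R -> R^o) :=
  [set u : Khat R -> R^o | exists p : {mpoly R[3]}, (msize p <= r.+1)%N /\
     forall q : Khat R,
       u q = let: (xi, eta, zeta) := sval q in
             p.@[tnth [tuple xi; eta; zeta]]].

Arguments Qspace R r : clear implicits.
Arguments Sspace R r : clear implicits.
Arguments Pspace R r : clear implicits.

(* Main.v *)
(** On the finite part of the pyramid, 1/(1+z) = 1 - zeta, so x^a y^b / (1+z)^(a+b+j)
    is xi^a eta^b (1 - zeta)^j, and both sides also agree at the apex. Writing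
    zeta^k = (1 - (1 - zeta))^k, the binomial theorem expands xi^a eta^b zeta^k in
    such functions with j <= k. They all lie in the smaller space S, because
    sldeg(x^a y^b) <= a + b. *)

Require Import Defs.
From mathcomp Require Import all_boot all_order all_algebra.
From mathcomp Require Import classical_sets reals.
From mathcomp Require Import boolp functions mpoly ring lra.

Set Implicit Arguments.
Unset Strict Implicit.
Unset Printing Implicit Defensive.

Import Order.TTheory GRing.Theory Num.Theory.

Local Open Scope classical_set_scope.
Local Open Scope ring_scope.

Section LinearSpan.
Context {R : realType} {V : lmodType R}.
Implicit Types (G : set V) (u v : V).

Lemma linspan_gen G v : G v -> linspan G v.
Proof.
move=> Gv; exists 1, (fun=> 1), (fun=> v); split=> //.
by rewrite big_ord1 scale1r.
Qed.

Lemma linspan0 G : linspan G 0.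
Proof.
by exists 0, (fun=> 0), (fun=> 0); split; [case | rewrite big_ord0].
Qed.

Lemma linspanD G u v : linspan G u -> linspan G v -> linspan G (u + v).
Proof.
move=> [m [k [g [Gg ->]]]] [n [l [h [Gh ->]]]].
exists (m + n)%N.
exists (fun i => match fintype.split i with inl j => k j | inr j => l j end).
exists (fun i => match fintype.split i with inl j => g j | inr j => h j end).
split=> [i|]; first by case: (fintype.split i).
rewrite big_split_ord; congr (_ + _); apply: eq_bigr => i _.
- by rewrite (unsplitK (inl i)).
- by rewrite (unsplitK (inr i)).
Qed.

Lemma linspanZ G (c : R) v : linspan G v -> linspan G (c *: v).
Proof.
move=> [n [k [g [Gg ->]]]]; exists n, (fun i => c * k i), g; split=> //.
by rewrite scaler_sumr; apply: eq_bigr => i _; rewrite scalerA.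
Qed.

(** The hypothesis is restricted to [i \in s] so that, for a sum over the support of a polynomial,
    the degree bound on its monomials is at hand. *)
Lemma linspan_sum G (I : eqType) (s : seq I) (F : I -> V) :
  (forall i, i \in s -> linspan G (F i)) -> linspan G (\sum_(i <- s) F i).
Proof.
move=> GF; rewrite big_seq.
by apply: big_ind => [|u v|i /GF //]; [exact: linspan0 | exact: linspanD].
Qed.

Lemma linspan_sub G H : G `<=` H -> linspan G `<=` linspan H.
Proof.
by move=> GH v [n [k [g [Gg ->]]]]; exists n, k, g; split=> // i; apply: GH.
Qed.

End LinearSpan.

Lemma Sspace_sub_Qspace (R : realType) (r : nat) : Sspace R r `<=` Qspace R r.
Proof.
apply: linspan_sub => f [a [b [c [ac bc cr _ ->]]]].
by exists a, b, c; split.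
Qed.

Lemma sldeg_le (a b : nat) : (sldeg a b <= a + b)%N.
Proof. by apply: leq_add; case: ifP. Qed.

(** The denominator splits along the exponent [a + b + j]: a factors 1 + z turn x into xi, b of them
    turn y into eta, and the other j give the power of 1 - zeta. *)
Lemma rat_monoE {R : realType} (a b j : nat) (p : Kinf R) :
  rat_mono a b (a + b + j) p =
  let: (xi, eta, zeta) := sval (phi p) in
  xi ^+ a * eta ^+ b * (1 - zeta) ^+ j.
Proof.
case: p => [[[[x y] z] /= xyzK]|] /=.
  have /and3P[_ _ z0] := xyzK.
  have z1 : 1 + z != 0 by rewrite gt_eqF //; lra.
  have -> : 1 - z / (1 + z) = (1 + z)^-1 by field.
  by rewrite !expr_div_n -exprVn !exprD !exprVn; field; rewrite !expf_neq0.
(* At the apex all three bases are 0. Since [0 ^+ 0 = 1], the product is 1 exactly when a = b = j =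
   0, as in [rat_mono]. *)
rewrite subrr !expr0n !addn_eq0.
by case: (a == 0%N); case: (b == 0%N); case: (j == 0%N);
  rewrite /= ?mulr0 ?mul0r ?mulr1.
Qed.

Lemma pullback_monomial_in_Sspace (R : realType) (r a b k : nat) :
  (a + b + k <= r)%N ->
  Sspace R r (fun p => let: (xi, eta, zeta) := sval (phi p) in
                       xi ^+ a * eta ^+ b * zeta ^+ k).
Proof.
move=> abk_le_r.
set f := (f in Sspace R r f).
(* The coefficients are those of (1 - (1 - zeta))^k in powers of 1 - zeta. *)
have -> : f = \sum_(j <- index_enum 'I_k.+1)
    ((-1) ^+ j *+ 'C(k, j)) *: (rat_mono a b (a + b + j) : Kinf R -> R^o).
  apply/funext => p; rewrite fct_sumE /f.
  under eq_bigr do rewrite /GRing.scale /= rat_monoE.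
  case: (sval (phi p)) => [[xi eta] zeta].
  rewrite -[in LHS](subKr 1 zeta) exprBn mulr_sumr.
  apply: eq_bigr => j _; rewrite expr1n mulr1 /GRing.scale /=.
  by rewrite -mulr_natr -[in RHS]mulr_natr; ring.
apply: linspan_sum => j _; apply/linspanZ/linspan_gen.
(* As j <= k, the exponent c = a + b + j is at most a + b + k <= r. *)
exists a, b, (a + b + j)%N; split=> //.
- by rewrite -addnA leq_addr.
- by rewrite addnAC leq_addl.
- by apply: leq_trans abk_le_r; rewrite leq_add2l -ltnS.
- exact: leq_trans (sldeg_le a b) (leq_addr _ _).
Qed.

Lemma Pspace_sub_Sspace (R : realType) (r : nat) :
  Pspace R r `<=` phi_space (Sspace R r).
Proof.
move=> u [P [P_le_r uE]]; rewrite /phi_space /=.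
pose i0 : 'I_3 := ord0; pose i1 : 'I_3 := lift ord0 ord0; pose i2 : 'I_3 := ord_max.
have -> : u \o @phi R = \sum_(m <- msupp P) P@_m *:
    ((fun p => let: (xi, eta, zeta) := sval (phi p) in
       xi ^+ m i0 * eta ^+ m i1 * zeta ^+ m i2) : Kinf R -> R^o).
  apply/funext => p; rewrite fct_sumE /= uE.
  case E : (sval (phi p)) => [[xi eta] zeta].
  rewrite mevalE; apply: eq_bigr => m _; rewrite /GRing.scale /= E.
  congr (_ * _); rewrite !big_ord_recl big_ord0 mulr1 mulrA.
  (* The third index appears as an iterated [lift], equal to [ord_max] by value. *)
  by congr (_ * _ * _ ^+ (m _)); apply: val_inj.
apply: linspan_sum => m mP; apply/linspanZ/pullback_monomial_in_Sspace.
(* A monomial in the support has degree strictly below [msize P <= r.+1], hence at most r. *)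
have := leq_trans (msize_mdeg_lt mP) P_le_r.
rewrite ltnS mdegE !big_ord_recl big_ord0 addn0 addnA.
by have -> : lift ord0 (lift ord0 ord0) = i2 by apply: val_inj.
Qed.

Theorem theorem2 (R : realType) (r : nat) :
  Pspace R r `<=` phi_space (Qspace R r) /\
  Pspace R r `<=` phi_space (Sspace R r).
Proof.
(* The first inclusion follows from the second, because S lies in Q. *)
split=> [u /Pspace_sub_Sspace|]; last exact: Pspace_sub_Sspace.
exact: Sspace_sub_Qspace.
Qed.
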